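(* Let $n\ge 1$, $N\ge 2$, $M>0$, $\Delta t>0$, and consider a harmonic-network Gaussian reservoir system (as defined in the context) of $N$ oscillators with interaction time $\Delta t$, whose inputs are the uniformly bounded left-infinite sequences $\mathbf{s}\in K_M$. Suppose the ancilla parameters $n_{th},r,\varphi,|\alpha|,\arg(\alpha)$ are continuous functions of the input vector, and let the readout $h$ be a polynomial in the elements of the reservoir covariance matrix $\sigma(\mathbf{x}^R_k)$ or a polynomial in the elements of the reservoir first moments vector $\langle\mathbf{x}^R_k\rangle$. Then the reservoir system has both the echo state property and the fading memory property if and only if the matrix $\mathbf{A}$ (the reservoir-reservoir block of $\mathbf{S}(\Delta t)$) has spectral radius $\rho(\mathbf{A})<1$.
   Context: **Inputs.** For $n\ge1$, $M>0$ let $K_M=\{\mathbf{s}=(\ldots,\mathbf{s}_{-2},\mathbf{s}_{-1},\mathbf{s}_0): \mathbf{s}_k\in\mathbb{R}^n,\ \lVert\mathbf{s}_k\rVert\le M \text{ for all } k\le 0\}$ be the set of left-infinite sequences uniformly bounded by $M$. **Network.** There are $N\ge2$ oscillators with frequencies $\omega_1,\ldots,\omega_N>0$ and symmetric interaction strengths $g_{ij}=g_{ji}\ge0$, $g_{ii}=0$. Let $\mathbf{L}_{ij}=\delta_{ij}\sum_k g_{ik}-(1-\delta_{ij})g_{ij}$ and $\mathbf{K}=\mathrm{diag}(\omega_1^2,\ldots,\omega_N^2)+\mathbf{L}$. The Hamiltonian is $H=\frac12\mathbf{p}^\top\mathbf{p}+\frac12\mathbf{q}^\top\mathbf{K}\mathbf{q}$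 (with $\hbar=1$). Order the operators as $\mathbf{x}^\top=(q_1,p_1,q_2,p_2,\ldots,q_N,p_N)$. The symplectic matrix $\mathbf{S}(\Delta t)\in \mathrm{Sp}(2N,\mathbb{R})$ is the linear flow at time $\Delta t$ of $\dot{\mathbf{q}}=\mathbf{p}$, $\dot{\mathbf{p}}=-\mathbf{K}\mathbf{q}$, written in this ordering. Oscillator $N$ is the ancilla; oscillators $1,\ldots,N-1$ form the reservoir. Write $$\mathbf{S}(\Delta t)=\begin{pmatrix}\mathbf{A}&\mathbf{B}\\ \mathbf{C}&\mathbf{D}\end{pmatrix},$$ with $\mathbf{A}$ of size $2(N-1)\times2(N-1)$ and $\mathbf{D}$ of size $2\times2$. **Encoding.** At each step $k$ the ancilla is reset to a single-mode Gaussian state with parameters $n_{th}\ge0$, $r\in\mathbb{R}$, $\varphi\in\mathbb{R}$, $|\alpha|\ge0$, $\arg(\alpha)\in\mathbb{R}$, each a function of $\mathbf{s}_k$. With $\Omega=\omega_N$ its covariance matrix and first moments are $$\sigma(\mathbf{x}^A_k)=(n_{th}+\tfrac12)\begin{pmatrix}(\cosh 2r+\cos\varphi\,\sinh 2r)\,\Omega^{-1}&\sin\varphi\,\sinh 2r\\ \sin\varphi\,\sinh 2r&(\cosh 2r-\cos\varphi\,\sinh 2r)\,\Omega\end{pmatrix},\qquad \langle\mathbf{x}^A_k\rangle=\begin{pmatrix}|\alpha|\cos(\arg\alpha)\sqrt{2\Omega^{-1}}\\ |\alpha|\sin(\arg\alpha)\sqrt{2\Omega}\end{pmatrix}.$$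 **Reservoir system.** The reservoir state at step $k$ is the Gaussian state given by the pair $(\langle\mathbf{x}^R_k\rangle,\sigma(\mathbf{x}^R_k))\in\mathbb{R}^{2(N-1)}\times\mathrm{Sym}_{2(N-1)}(\mathbb{R})$. The reservoir dynamics is $\mathbf{x}^R_k=\mathbf{A}\mathbf{x}^R_{k-1}+\mathbf{B}\mathbf{x}^A_k$, with the fresh ancilla uncorrelated with the reservoir, i.e. $$\langle\mathbf{x}^R_k\rangle=\mathbf{A}\langle\mathbf{x}^R_{k-1}\rangle+\mathbf{B}\langle\mathbf{x}^A_k\rangle,\qquad \sigma(\mathbf{x}^R_k)=\mathbf{A}\,\sigma(\mathbf{x}^R_{k-1})\mathbf{A}^\top+\mathbf{B}\,\sigma(\mathbf{x}^A_k)\mathbf{B}^\top .$$ The output is $o_k=h(\mathbf{x}^R_k)$, meaning a real function of the state $(\langle\mathbf{x}^R_k\rangle,\sigma(\mathbf{x}^R_k))$. Initial conditions are arbitrary Gaussian states: an arbitrary real first moments vector and any real symmetric $\sigma$ with $\sigma+\frac{i}{2}J\ge0$, where $J=\bigoplus_{j=1}^{N-1}\begin{pmatrix}0&1\\-1&0\end{pmatrix}$. **Echo state property (ESP).** In the limit of infinitely many inputs the reservoir state is completely determined by the inputs and not by the initial conditions: for every $\mathbf{s}\in K_M$ and every initial reservoir state, the state at step $0$ obtained by starting in that initial state at step $-m$ and processing $\mathbf{s}_{-m+1},\ldots,\mathbf{s}_0$ converges as $m\to\infty$ to a limit $\mathcal{E}(\mathbf{s})$ that does not depend on the initial state. The system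 then induces the functional $F:K_M\to\mathbb{R}$, $F(\mathbf{s})=h(\mathcal{E}(\mathbf{s}))$. **Fading memory property (FMP).** A null sequence is a decreasing sequence $w:\mathbb{N}_0\to(0,1]$ with $\lim_{k\to\infty}w_k=0$. A functional $F:K_M\to\mathbb{R}$ has the FMP if there is a null sequence $w$ such that $F$ is continuous on $K_M$ with respect to the metric induced by the weighted norm $\lVert\mathbf{s}\rVert_w=\sup_{k\ge0}w_k\lVert\mathbf{s}_{-k}\rVert$. The reservoir system has the FMP if its induced functional does. *)

(* Defs.v *)
From HB Require Import structures.
From mathcomp Require Import all_boot all_order all_algebra.
From mathcomp Require Import all_classical all_reals all_analysis.
From mathcomp Require Import complex.
(* Not imported: its notations clash with those of the analysis library. *)
From mathcomp Require mpoly.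

Set Implicit Arguments.
Unset Strict Implicit.
Unset Printing Implicit Defensive.

Import Order.TTheory GRing.Theory Num.Theory.
Import numFieldTopology.Exports numFieldNormedType.Exports.

Local Open Scope classical_set_scope.
Local Open Scope ring_scope.

(* The library norm on matrices is the max norm. *)
Definition enorm (R : realType) (n : nat) (x : 'cV[R]_n) : R :=
  Num.sqrt (\sum_(i < n) x i 0 ^+ 2).

(* A left-infinite sequence (..., s_{-1}, s_0) is encoded as s : nat -> 'cV_n
   with [s k] standing for s_{-k}. *)
Definition input (R : realType) (n : nat) : Type := nat -> 'cV[R]_n.

Definition K_ (R : realType) (n : nat) (M : R) : set (input R n) :=
  [set s | forall k, enorm (s k) <= M].

(* There are N = m.+1 oscillators: ord_max is the ancilla, the other m form the
   reservoir. *)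

Definition laplacian (R : realType) (m : nat) (g : 'I_m.+1 -> 'I_m.+1 -> R) :
    'M[R]_m.+1 :=
  \matrix_(i, j) (if i == j then \sum_k g i k else - g i j).

Definition potential (R : realType) (m : nat) (omega : 'I_m.+1 -> R)
    (g : 'I_m.+1 -> 'I_m.+1 -> R) : 'M[R]_m.+1 :=
  diag_mx (\row_i omega i ^+ 2) + laplacian g.

Lemma q_idx_subproof (m : nat) (i : 'I_m.+1) : (2 * i < 2 * m + 2)%N.
Proof. by rewrite -mulnSr ltn_mul2l /=. Qed.

Lemma p_idx_subproof (m : nat) (i : 'I_m.+1) : (2 * i + 1 < 2 * m + 2)%N.
Proof. by rewrite addn1 addn2 !ltnS leq_mul2l /= -ltnS. Qed.

(* Position of q_i and p_i in the ordering (q_1, p_1, ..., q_N, p_N). *)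
Definition q_idx (m : nat) (i : 'I_m.+1) : 'I_(2 * m + 2) :=
  Ordinal (q_idx_subproof i).
Definition p_idx (m : nat) (i : 'I_m.+1) : 'I_(2 * m + 2) :=
  Ordinal (p_idx_subproof i).

Definition q_part (R : realType) (m : nat) (x : 'cV[R]_(2 * m + 2)) :
    'cV[R]_m.+1 := \col_i x (q_idx i) 0.
Definition p_part (R : realType) (m : nat) (x : 'cV[R]_(2 * m + 2)) :
    'cV[R]_m.+1 := \col_i x (p_idx i) 0.

(* S is the linear flow of q' = p, p' = - K q: every trajectory t |-> S(t) x0
   starts at x0 and solves the equations of motion. *)
Definition is_hamiltonian_flow (R : realType) (m : nat) (K : 'M[R]_m.+1)
    (S : R -> 'M[R]_(2 * m + 2)) : Prop :=
  forall x0 : 'cV[R]_(2 * m + 2),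
    S 0 *m x0 = x0 /\
    forall (t : R) (i : 'I_m.+1),
      is_derive t 1 (fun u => q_part (S u *m x0) i 0)
        (p_part (S t *m x0) i 0) /\
      is_derive t 1 (fun u => p_part (S u *m x0) i 0)
        (- (K *m q_part (S t *m x0)) i 0).

Record encoding (R : realType) (n : nat) : Type := Encoding {
  n_th : 'cV[R]_n -> R;
  squeeze : 'cV[R]_n -> R;   (* r *)
  phase : 'cV[R]_n -> R;     (* varphi *)
  amp : 'cV[R]_n -> R;       (* |alpha| *)
  arg : 'cV[R]_n -> R        (* arg(alpha) *)
}.

Definition cosh (R : realType) (x : R) : R := (expR x + expR (- x)) / 2.
Definition sinh (R : realType) (x : R) : R := (expR x - expR (- x)) / 2.

Definition ancilla_cov (R : realType) (n : nat) (Omega : R)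
    (e : encoding R n) (x : 'cV[R]_n) : 'M[R]_2 :=
  let c := cosh (2 * squeeze e x) in
  let s := sinh (2 * squeeze e x) in
  let f := phase e x in
  (n_th e x + 2^-1) *:
    (block_mx ((c + cos f * s) * Omega^-1)%:M (sin f * s)%:M
              (sin f * s)%:M ((c - cos f * s) * Omega)%:M : 'M[R]_(1 + 1)).

Definition ancilla_mean (R : realType) (n : nat) (Omega : R)
    (e : encoding R n) (x : 'cV[R]_n) : 'cV[R]_2 :=
  (col_mx (amp e x * cos (arg e x) * Num.sqrt (2 * Omega^-1))%:M
          (amp e x * sin (arg e x) * Num.sqrt (2 * Omega))%:M
    : 'cV[R]_(1 + 1)).

(* A Gaussian state of m modes: (first moments, covariance matrix). *)
Definition gstate (R : realType) (m : nat) : Type :=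
  ('cV[R]_(2 * m) * 'M[R]_(2 * m))%type.

(* Direct sum of m blocks [0 1; -1 0] (indices start at 0). *)
Definition Jmx (R : realType) (m : nat) : 'M[R]_(2 * m) :=
  \matrix_(i, j) (if ~~ odd i && (j == i.+1 :> nat) then 1
                  else if ~~ odd j && (i == j.+1 :> nat) then -1 else 0).

(* On R[i], [0 <= z] means that z is real and nonnegative. *)
Definition psd (R : realType) (d : nat) (A : 'M[R[i]]_d) : Prop :=
  forall z : 'cV[R[i]]_d, 0 <= ((map_mx (@conjc R) z)^T *m A *m z) 0 0.

Definition gaussian (R : realType) (m : nat) (x : gstate R m) : Prop :=
  x.2^T = x.2 /\
  psd (map_mx (real_complex R) x.2
       + ('i%C / 2) *: map_mx (real_complex R) (Jmx R m)).

Definition reservoir_step (R : realType) (n m : nat) (A : 'M[R]_(2 * m))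
    (B : 'M[R]_(2 * m, 2)) (Omega : R) (e : encoding R n)
    (u : 'cV[R]_n) (x : gstate R m) : gstate R m :=
  (A *m x.1 + B *m ancilla_mean Omega e u,
   A *m x.2 *m A^T + B *m ancilla_cov Omega e u *m B^T).

(* State at step 0 when starting in x at step -k and processing
   s_{-k+1}, ..., s_0. *)
Fixpoint run (R : realType) (n : nat) (X : Type) (f : 'cV[R]_n -> X -> X)
    (s : input R n) (k : nat) (x : X) : X :=
  if k is k'.+1 then run f s k' (f (s k') x) else x.

Definition is_echo (R : realType) (n m : nat)
    (f : 'cV[R]_n -> gstate R m -> gstate R m) (s : input R n)
    (E : 'cV[R]_(2 * m) * 'M[R]_(2 * m)) : Prop :=
  forall x : gstate R m, gaussian x ->
    (fun k => run f s k x : 'cV[R]_(2 * m) * 'M[R]_(2 * m)) @ \oo --> E.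

Definition echo_state_property (R : realType) (n m : nat) (M : R)
    (f : 'cV[R]_n -> gstate R m -> gstate R m) : Prop :=
  forall s, K_ M s -> exists E, is_echo f s E.

(* F(s) = h(E(s)); meaningful on K_ M when the echo state property holds. *)
Definition induced_functional (R : realType) (n m : nat)
    (f : 'cV[R]_n -> gstate R m -> gstate R m) (h : gstate R m -> R)
    (s : input R n) : R :=
  h (get (is_echo f s)).

Definition null_sequence (R : realType) (w : nat -> R) : Prop :=
  [/\ forall k, 0 < w k <= 1, decreasing_seq w & w @ \oo --> (0 : R)].

Definition weighted_norm (R : realType) (n : nat) (w : nat -> R)
    (s : input R n) : R :=
  sup [set w k * enorm (s k) | k in [set: nat]].

Definition has_fading_memory (R : realType) (n : nat) (M : R)
    (F : input R n -> R) : Prop :=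
  exists2 w : nat -> R, null_sequence w &
    forall s, K_ M s -> forall eps : R, 0 < eps ->
      exists2 delta : R, 0 < delta &
        forall s', K_ M s' ->
          weighted_norm w (fun k => s' k - s k) < delta ->
          `|F s' - F s| < eps.

Definition fading_memory_property (R : realType) (n m : nat) (M : R)
    (f : 'cV[R]_n -> gstate R m -> gstate R m) (h : gstate R m -> R) : Prop :=
  has_fading_memory M (induced_functional f h).

Definition polynomial_readout (R : realType) (m : nat) (h : gstate R m -> R) :
    Prop :=
  (exists p : mpoly.mpoly (2 * m * (2 * m)) R,
     forall x, h x = mpoly.meval (fun k => mxvec x.2 0 k) p) \/
  (exists p : mpoly.mpoly (2 * m) R,
     forall x, h x = mpoly.meval (fun k => x.1 k 0) p).

(* Maximum modulus of the complex eigenvalues; [Re `|l|] is the modulus of l as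
   an element of R. *)
Definition spectral_radius (R : realType) (d : nat) (A : 'M[R]_d) : R :=
  sup [set complex.Re `|l| | l in
        [set l : R[i] | eigenvalue (map_mx (real_complex R) A) l]].

(* Main.v *)
(* Unrolling k steps gives, with b(u) and c(u) the injected first moments and
   covariance,
     mean = A^k mean_0 + \sum_(j < k) A^j b(s_j),
     cov  = A^k cov_0 (A^k)^T + \sum_(j < k) A^j c(s_j) (A^j)^T.
   If the state forgets its initial condition, the difference of two runs with
   the same covariance shows A^k x -> 0 for every x, hence every eigenvalue has
   modulus < 1. Conversely, if all eigenvalues have modulus < q < 1, factoring
   the characteristic polynomial in Cayley-Hamilton turns A^k into a cascade of
   scalar recurrences u_(k+1) = z u_k + w_k, so A^k = O(q^k). As b and c are
   bounded on the compact ball of inputs, both sums converge geometrically,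
   uniformly in the input sequence; each term depends continuously on a single
   coordinate s_j, so the limit is continuous for the weighted norm of the null
   sequence 1/(k+1), and so is every polynomial in its entries. *)
Require Import Defs.
From mathcomp Require Import all_boot all_order all_algebra.
From mathcomp Require Import all_classical all_reals all_analysis.
From mathcomp Require Import complex ring lra.
From mathcomp Require mpoly.
Import Order.TTheory GRing.Theory Num.Theory.
Import numFieldTopology.Exports numFieldNormedType.Exports.
Local Open Scope classical_set_scope.
Local Open Scope ring_scope.

Set Implicit Arguments.
Unset Strict Implicit.
Unset Printing Implicit Defensive.

(** * The entrywise l1 norm of matrices *)

(** A submultiplicative norm valued in the scalars themselves, so that one development serves both
    [R] and [R[i]]. *)
Definition l1norm (K : numDomainType) (p r : nat) (X : 'M[K]_(p, r)) : K :=
  \sum_i \sum_j `|X i j|.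

Section L1Norm.
Variable K : numDomainType.

Lemma l1norm_ge0 (p r : nat) (X : 'M[K]_(p, r)) : 0 <= l1norm X.
Proof. by do 2![apply: sumr_ge0 => ? _]. Qed.

Lemma ler_l1norm_entry (p r : nat) (X : 'M[K]_(p, r)) i j : `|X i j| <= l1norm X.
Proof.
rewrite /l1norm (bigD1 i) //= (bigD1 j) //= -addrA lerDl addr_ge0 ?sumr_ge0 //.
by move=> k _; rewrite sumr_ge0.
Qed.

Lemma ler_l1normD (p r : nat) (X Y : 'M[K]_(p, r)) :
  l1norm (X + Y) <= l1norm X + l1norm Y.
Proof.
rewrite -big_split /= ler_sum // => i _; rewrite -big_split /= ler_sum // => j _.
by rewrite mxE ler_normD.
Qed.

Lemma l1normZ (p r : nat) (a : K) (X : 'M[K]_(p, r)) :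
  l1norm (a *: X) = `|a| * l1norm X.
Proof.
rewrite /l1norm mulr_sumr; apply: eq_bigr => i _.
by rewrite mulr_sumr; apply: eq_bigr => j _; rewrite mxE normrM.
Qed.

Lemma l1norm_tr (p r : nat) (X : 'M[K]_(p, r)) : l1norm X^T = l1norm X.
Proof.
rewrite /l1norm exchange_big /=; apply: eq_bigr => i _.
by apply: eq_bigr => j _; rewrite mxE.
Qed.

Lemma ler_l1normM (p r t : nat) (X : 'M[K]_(p, r)) (Y : 'M[K]_(r, t)) :
  l1norm (X *m Y) <= l1norm X * l1norm Y.
Proof.
rewrite {1 2}/l1norm mulr_suml ler_sum // => i _.
apply: (@le_trans _ _ (\sum_j \sum_k `|X i k| * `|Y k j|)).
  rewrite ler_sum // => j _; rewrite mxE (le_trans (ler_norm_sum _ _ _)) //.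
  by rewrite ler_sum // => k _; rewrite normrM.
rewrite exchange_big /= mulr_suml ler_sum // => k _.
rewrite -mulr_sumr ler_wpM2l // /l1norm [leRHS](bigD1 k) //= lerDl.
by do 2![apply: sumr_ge0 => ? _].
Qed.

End L1Norm.

(** * Geometric decay of matrix powers *)

Lemma geometric_recurrence (K : numFieldType) (p r : nat)
    (u w : nat -> 'M[K]_(p, r)) (z q C : K) :
  0 <= C -> `|z| < q -> (forall k, u k.+1 = z *: u k + w k) ->
  (forall k, l1norm (w k) <= C * q ^+ k) ->
  exists2 C', 0 <= C' & forall k, l1norm (u k) <= C' * q ^+ k.
Proof.
move=> C0 zq uS wC; have q0 : 0 < q by apply: le_lt_trans zq.
have qz : 0 < q - `|z| by rewrite subr_gt0.
(* This constant $C'$ satisfies $|z| C' + C \le q C'$, which makes the bound inductive. *)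
exists (l1norm (u 0) + C / (q - `|z|)).
  by rewrite addr_ge0 ?l1norm_ge0 // divr_ge0 // ltW.
elim=> [|k IH]; first by rewrite mulr1 lerDl divr_ge0 // ltW.
rewrite uS (le_trans (ler_l1normD _ _)) // l1normZ.
apply: le_trans (lerD (ler_wpM2l (normr_ge0 z) IH) (wC k)) _.
rewrite exprS mulrA -mulrDl (mulrA _ q) ler_wpM2r ?exprn_ge0 ?(ltW q0) //.
rewrite (mulrC `|z|) -lerBrDl -mulrBr mulrDl divfK ?gt_eqF // lerDr.
by rewrite mulr_ge0 ?l1norm_ge0 // ltW.
Qed.

(** Induction on the roots, for all [Q] at once: the remaining factors annihilate $(A - z)Q$, and
    $u_k = A^k Q$ satisfies $u_{k+1} = z u_k + A^k (A - z) Q$, whose last term is geometric by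
    induction. *)
Lemma annihilated_powers_geometric (K : numFieldType) (d : nat)
    (A : 'M[K]_d.+1) (q : K) (s : seq K) (r : nat) (Q : 'M[K]_(d.+1, r)) :
  {in s, forall z, `|z| < q} ->
  horner_mx A (\prod_(z <- s) ('X - z%:P)) *m Q = 0 ->
  exists2 C, 0 <= C & forall k, l1norm (A ^+ k *m Q) <= C * q ^+ k.
Proof.
elim: s Q => [|z s IH] Q sq.
  rewrite big_nil rmorph1 mul1mx => ->; exists 0 => // k.
  rewrite mulmx0 mul0r /l1norm !big1 // => i _.
  by rewrite big1 // => j _; rewrite mxE normr0.
rewrite big_cons mulrC rmorphM /= -mulmxE -mulmxA => QE.
have [|C C0 hC] := IH _ _ QE.
  by move=> x xs; apply: sq; rewrite in_cons xs orbT.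
apply: (@geometric_recurrence _ _ _ _
  (fun k => A ^+ k *m (horner_mx A ('X - z%:P) *m Q)) z q C C0) => //.
  by apply: sq; rewrite in_cons eqxx.
move=> k; rewrite rmorphB /= horner_mx_X horner_mx_C mulmxBl mulmxBr.
by rewrite mul_scalar_mx -scalemxAr addrC subrK exprSr -mulmxE mulmxA.
Qed.

Lemma eigenvalues_powers_geometric (K : numClosedFieldType) (d : nat)
    (A : 'M[K]_d) (q : K) :
  (forall z, eigenvalue A z -> `|z| < q) ->
  exists2 C, 0 <= C & forall k, l1norm (A ^+ k) <= C * q ^+ k.
Proof.
case: d A => [|d] A Aq.
  (* The annihilation lemma covers size [d.+1]; an empty matrix has norm 0. *)
  by exists 0 => // k; rewrite /l1norm big_ord0 mul0r.
have [s sE] := closed_field_poly_normal (char_poly A).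
have s_eig : {in s, forall z, `|z| < q}.
  move=> z zs; apply: Aq; rewrite eigenvalue_root_char sE.
  by rewrite (monicP (char_poly_monic A)) scale1r root_prod_XsubC.
rewrite (monicP (char_poly_monic A)) scale1r in sE.
have [|C C0 hC] := @annihilated_powers_geometric K d A q s _ 1%:M s_eig.
  by rewrite -sE Cayley_Hamilton mul0mx.
by exists C => // k; rewrite -[A ^+ k]mulmx1.
Qed.

(** * Spectral radius and complex eigenvalues of a real matrix *)

Section SpectralRadius.
Variable R : realType.
Local Open Scope complex_scope.

Lemma re_norm_real (z : R[i]) : (complex.Re `|z|)%:C = `|z|.
Proof. exact/RRe_real/normr_real. Qed.

Lemma l1norm_complex (p r : nat) (A : 'M[R]_(p, r)) :
  l1norm (map_mx (real_complex R) A) = (l1norm A)%:C.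
Proof.
rewrite /l1norm rmorph_sum; apply: eq_bigr => i _.
rewrite rmorph_sum; apply: eq_bigr => j _.
by rewrite mxE normc_def /= expr0n addr0 sqrtr_sqr.
Qed.

Lemma map_mx_complex_exp (d : nat) (A : 'M[R]_d) k :
  map_mx (real_complex R) (A ^+ k) = (map_mx (real_complex R) A) ^+ k.
Proof.
elim: k => [|k IH]; first by rewrite !expr0 map_mx1.
by rewrite !exprS -!mulmxE map_mxM /= IH.
Qed.

Lemma eigenvalues_finite (d : nat) (A : 'M[R[i]]_d) :
  exists s : seq R[i], forall z, eigenvalue A z -> z \in s.
Proof.
have [s sE] := closed_field_poly_normal (char_poly A).
exists s => z; rewrite eigenvalue_root_char sE (monicP (char_poly_monic A)).
by rewrite scale1r root_prod_XsubC.
Qed.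

Lemma eigenvalue_le_spectral_radius (d : nat) (A : 'M[R]_d) (z : R[i]) :
  eigenvalue (map_mx (real_complex R) A) z ->
  complex.Re `|z| <= spectral_radius A.
Proof.
move=> Az; apply: ub_le_sup; last by exists z.
have [s hs] := eigenvalues_finite (map_mx (real_complex R) A).
(* Finiteness of the spectrum provides the upper bound that [sup] requires. *)
exists (\big[Num.max/0]_(x <- s) complex.Re `|x|) => _ [x /= Ax <-].
by apply: le_bigmax_seq => //; apply: hs.
Qed.

(** A supremum of values below 1 may equal 1; finiteness of the spectrum turns it into a maximum. *)
Lemma spectral_radius_lt1 (d : nat) (A : 'M[R]_d) :
  (forall z, eigenvalue (map_mx (real_complex R) A) z -> `|z| < 1) ->
  spectral_radius A < 1.
Proof.
move=> A1; have [s hs] := eigenvalues_finite (map_mx (real_complex R) A).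
set E := [set l | eigenvalue (map_mx (real_complex R) A) l].
have [E0|E0] := eqVneq E set0.
  (* Only an empty matrix has no eigenvalue; the supremum of the empty set is 0. *)
  by rewrite /spectral_radius -/E E0 image_set0 sup0.
(* The list [s] is only known to contain the eigenvalues, hence the restriction to [E]. *)
apply: (@le_lt_trans _ _ (\big[Num.max/0]_(x <- s | x \in E) complex.Re `|x|)).
  apply: ge_sup.
    by have /set0P[x Ex] := E0; exists (complex.Re `|x|), x.
  move=> _ [x /= Ax <-]; apply: le_bigmax_seq => //; first exact: hs.
  exact/mem_set.
rewrite bigmax_lt // => x /set_mem Ax.
by rewrite -ltcR re_norm_real; apply: A1.
Qed.

Lemma spectral_radius_powers_geometric (d : nat) (A : 'M[R]_d) :
  spectral_radius A < 1 ->
  exists C q, [/\ 0 <= C, 0 < q < 1 & forall k, l1norm (A ^+ k) <= C * q ^+ k].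
Proof.
(* [q] is the midpoint of [r] and 1, hence strictly above every eigenvalue modulus; the maximum with
   0 makes it positive. *)
move=> rA; pose r := Num.max (spectral_radius A) 0; pose q := (r + 1) / 2.
have r1 : r < 1 by rewrite gt_max rA ltr01.
have r0 : 0 <= r by rewrite le_max lexx orbT.
have Ar : spectral_radius A <= r by rewrite le_max lexx.
have [|C C0 hC] := @eigenvalues_powers_geometric _ _
    (map_mx (real_complex R) A) q%:C.
  move=> z Az; rewrite -re_norm_real ltcR.
  have := eigenvalue_le_spectral_radius Az.
  by rewrite /q; lra.
(* A nonnegative element of [R[i]] is real, so the constant descends to [R]. *)
have CE : (complex.Re C)%:C = C by apply/RRe_real/ger0_real.
exists (complex.Re C), q; split.
- by rewrite -lecR CE.
- by rewrite /q; lra.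
- move=> k; rewrite -lecR -l1norm_complex map_mx_complex_exp.
  by rewrite rmorphM rmorphXn /= CE.
Qed.

End SpectralRadius.

(** * Entrywise convergence of matrices and of polynomials in their entries *)

Lemma cvg_mx_entries (U : topologicalType) (T : Type) (F : set_system T)
    {FF : Filter F} (p r : nat) (X : T -> 'M[U]_(p, r)) (L : 'M[U]_(p, r)) :
  (forall i j, X t i j @[t --> F] --> L i j) -> X @ F --> L.
Proof.
move=> XL A [P LP sPA].
have XP : \forall t \near F, forall i j, P i j (X t i j).
  by apply: filter_forall => i; apply: filter_forall => j; apply: XL (LP i j).
by apply: filterS XP => t Pt; apply: sPA.
Qed.

Lemma cvg_mulmx_entry (K : numFieldType) (T : Type) (F : set_system T)
    {FF : Filter F} (p r t : nat) (X : T -> 'M[K]_(p, r)) (Y : T -> 'M[K]_(r, t))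
    (X0 : 'M[K]_(p, r)) (Y0 : 'M[K]_(r, t)) i j :
  (forall i j, X x i j @[x --> F] --> X0 i j) ->
  (forall i j, Y x i j @[x --> F] --> Y0 i j) ->
  (X x *m Y x) i j @[x --> F] --> (X0 *m Y0) i j.
Proof.
move=> XX0 YY0; rewrite mxE.
under eq_fun do rewrite mxE.
apply: cvg_big => [|k _]; first exact: add_continuous.
exact: cvgM.
Qed.

Lemma cvg_meval (K : numFieldType) (T : Type) (F : set_system T)
    {FF : Filter F} (d : nat) (p : mpoly.mpoly d K) (v : T -> 'I_d -> K)
    (l : 'I_d -> K) :
  (forall i, v t i @[t --> F] --> l i) ->
  mpoly.meval (v t) p @[t --> F] --> mpoly.meval l p.
Proof.
move=> vl; rewrite mpoly.mevalE.
under eq_fun do rewrite mpoly.mevalE.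
apply: cvg_big => [|a _]; first exact: add_continuous.
apply: cvgM; first exact: cvg_cst.
apply: cvg_big => [|i _]; first exact: mul_continuous.
elim: (mpoly.fun_of_multinom a i) => [|k IH]; first exact: cvg_cst.
rewrite exprS; under eq_fun do rewrite exprS.
exact: cvgM.
Qed.

(** * Euclidean balls and their compactness *)

Section EuclideanBall.
Variables (R : realType) (n : nat).

Lemma enorm_ge0 (x : 'cV[R]_n) : 0 <= enorm x.
Proof. exact: sqrtr_ge0. Qed.

Lemma ler_entry_enorm (x : 'cV[R]_n) i : `|x i 0| <= enorm x.
Proof.
rewrite -sqrtr_sqr ler_wsqrtr // (bigD1 i) //= lerDl.
by apply: sumr_ge0 => j _; rewrite sqr_ge0.
Qed.

Lemma ler_enormB (x y : 'cV[R]_n) (M : R) :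
  enorm x <= M -> enorm y <= M -> enorm (x - y) <= 2 * M.
Proof.
move=> xM yM; have M0 : 0 <= M := le_trans (enorm_ge0 x) xM.
have sqM (z : 'cV[R]_n) : enorm z <= M -> \sum_(i < n) z i 0 ^+ 2 <= M ^+ 2.
  move=> zM; rewrite -(@sqr_sqrtr _ (\sum_(i < n) _)); last first.
    by apply: sumr_ge0 => i _; rewrite sqr_ge0.
  by rewrite lerXn2r ?nnegrE ?enorm_ge0.
rewrite -(@ger0_norm _ (2 * M)) ?mulr_ge0 // -sqrtr_sqr ler_wsqrtr //.
(* The entrywise bound $(a-b)^2 \le 2a^2+2b^2$ replaces the triangle inequality and gives $4M^2$
   after summation. *)
apply: (@le_trans _ _ (\sum_(i < n) (2 * x i 0 ^+ 2 + 2 * y i 0 ^+ 2))).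
  apply: ler_sum => i _; rewrite !mxE -subr_ge0.
  rewrite (_ : _ - _ = (x i 0 + y i 0) ^+ 2) ?sqr_ge0 //; ring.
rewrite big_split /= -!mulr_sumr.
by have := sqM _ xM; have := sqM _ yM; lra.
Qed.

Lemma cvg_enorm (T : Type) (F : set_system T) {FF : Filter F}
    (x : T -> 'cV[R]_n) (l : 'cV[R]_n) :
  (forall i, x t i 0 @[t --> F] --> l i 0) -> enorm (x t) @[t --> F] --> enorm l.
Proof.
move=> xl; apply: (@continuous_cvg _ _ _ F _ (fun t => \sum_(i < n) x t i 0 ^+ 2) Num.sqrt).
  exact: sqrt_continuous.
apply: cvg_big => [|i _]; first exact: add_continuous.
apply: (@continuous_cvg _ _ _ _ _ _ (fun x : R => x ^+ 2)) (xl i).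
exact: exprn_continuous.
Qed.

(** For row vectors the ball is a closed subset of the compact cube $[-M,M]^n$; transposition is
    continuous and carries it to columns. *)
Lemma enorm_ball_compact (M : R) : compact [set u : 'cV[R]_n | enorm u <= M].
Proof.
pose f (v : 'rV[R]_n) : 'cV[R]_n := v^T.
have fc : continuous f.
  move=> v; apply: (@cvg_mx_entries _ _ (nbhs v) _ _ _ f) => i j; rewrite mxE.
  by under eq_fun do rewrite mxE; apply: coord_continuous.
rewrite (_ : [set _ | _] = f @` [set v | enorm (f v) <= M]); last first.
  rewrite predeqE => u; split => [uM|[v vM <-] //].
  by exists u^T; rewrite /f /= trmxK.
apply: continuous_compact; first exact: continuous_subspaceT.
apply: (@subclosed_compact _ _ [set v : 'rV[R]_n | forall i, `[- M, M]%classic (v ord0 i)]).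
- apply: (@closed_comp _ _ (fun v => enorm (f v)) [set y | y <= M]); last first.
    exact: closed_le.
  move=> v _; apply: (@cvg_enorm _ (nbhs v) _) => i; rewrite mxE.
  under eq_fun do rewrite mxE; exact: coord_continuous.
- by apply: (@rV_compact _ _ (fun=> `[- M, M]%classic)) => _; apply: segment_compact.
- move=> v /= vM i; rewrite /= in_itv /= -ler_norml.
  by have := ler_entry_enorm (f v) i; rewrite mxE => /le_trans; apply.
Qed.

Lemma continuous_ball_bounded (M : R) (f : 'cV[R]_n -> R) :
  {within [set u | enorm u <= M], continuous f} ->
  exists2 D, 0 <= D & forall u, enorm u <= M -> `|f u| <= D.
Proof.
move=> fc; have := compact_bounded (continuous_compact fc (@enorm_ball_compact M)).
(* Every number strictly above [D0] is a bound, hence the [+ 1]; the maximum with 0 ensures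
   nonnegativity. *)
case=> D0 [_ hD]; exists (Num.max D0 0 + 1).
  by rewrite addr_ge0 // le_max lexx orbT.
move=> u uM; apply: hD; last by exists u.
by rewrite ltr_pwDr // le_max lexx.
Qed.

End EuclideanBall.

(** * Series dominated by a geometric series *)

Section GeometricTail.
Variables (R : realType) (D q : R) (u : nat -> R).
Hypotheses (D0 : 0 <= D) (q01 : 0 < q < 1).
Hypothesis uD : forall j, `|u j| <= D * q ^+ j.

Lemma geometric_bound_cvg : cvgn (series u).
Proof.
have /andP[q0 q1] := q01.
apply: normed_cvg; apply: (@series_le_cvg _ (fun k => `|u k|) (geometric D q)).
- by move=> k.
- by move=> k; rewrite /geometric /= mulr_ge0 // exprn_ge0 // ltW.
- by move=> k; exact: uD.
- by apply: is_cvg_geometric_series; rewrite ger0_norm // ltW.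
Qed.

Lemma geometric_bound_tail J :
  `|limn (series u) - series u J| <= D * q ^+ J / (1 - q).
Proof.
have /andP[q0 q1] := q01; have q1' : 0 < 1 - q by rewrite subr_gt0.
(* The right-hand side is the exact finite geometric sum, so the induction step closes with
   equality; the tail bound is its limit. *)
have partial i : `|series u (J + i)%N - series u J| <=
    D * (q ^+ J - q ^+ (J + i)) / (1 - q).
  elim: i => [|i IH]; first by rewrite addn0 !subrr mulr0 mul0r normr0.
  rewrite addnS seriesSr addrAC (le_trans (ler_normD _ _)) //.
  rewrite (le_trans (lerD IH (uD _))) // exprS.
  rewrite -[X in _ + X](@mulfK _ (1 - q)) ?gt_eqF // -mulrDl.
  rewrite ler_pM2r ?invr_gt0 //.
  by rewrite le_eqVlt; apply/orP; left; apply/eqP; ring.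
have cu : `|series u k - series u J| @[k --> \oo] -->
    `|limn (series u) - series u J|.
  by apply: cvg_norm; apply: cvgB; [exact: geometric_bound_cvg|exact: cvg_cst].
rewrite -(cvg_lim _ cu) //; apply: limr_le; first by apply/cvg_ex; eexists; exact: cu.
near=> k; have Jk : (J <= k)%N by near: k; exact: nbhs_infty_ge.
rewrite -(subnKC Jk) (le_trans (partial _)) // ler_pM2r ?invr_gt0 //.
by rewrite ler_wpM2l // gerBl exprn_ge0 // ltW.
Unshelve. all: by end_near. Qed.

End GeometricTail.

(** * Weighted-norm neighbourhoods of bounded inputs *)

Section InputNeighbourhoods.
Variables (R : realType) (n : nat) (M : R) (w : nat -> R).
Hypothesis w01 : forall k, 0 < w k <= 1.

(** Fading memory is convergence along this filter, which makes the limit calculus available without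
    a topology on sequences. *)
Definition input_nbhs (s : input R n) : set_system (input R n) :=
  filter_from [set d : R | 0 < d]
    (fun d => [set s' | K_ M s' /\ weighted_norm w (fun k => s' k - s k) < d]).

Global Instance input_nbhs_filter s : Filter (input_nbhs s).
Proof.
apply: filter_from_filter; first by exists 1 => /=.
move=> d1 d2 /= d10 d20; exists (Num.min d1 d2); first by rewrite /= lt_min d10.
by move=> s' /= [Ks']; rewrite lt_min => /andP[].
Qed.

(** On [K_ M] the weighted differences are at most [2 * M], so the supremum is a genuine one and
    dominates each of its terms. *)
Lemma ler_weighted_norm (s s' : input R n) j : K_ M s -> K_ M s' ->
  w j * enorm (s' j - s j) <= weighted_norm w (fun k => s' k - s k).
Proof.
move=> Ks Ks'; apply: ub_le_sup; last by exists j.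
exists (2 * M) => _ [k _ <-]; have /andP[w0 w1] := w01 k.
apply: le_trans (ler_enormB (Ks' k) (Ks k)).
by rewrite ler_piMl // enorm_ge0.
Qed.

Lemma near_input_nbhs s : \forall s' \near input_nbhs s, K_ M s'.
Proof. by exists 1 => //= s' []. Qed.

(** As [w j] is positive, weighted distance below [w j * e] keeps the [j]-th inputs within [e]. The
    target filter is restricted to the ball, where the encoding is continuous. *)
Lemma cvg_input_coord (s : input R n) j : K_ M s ->
  s' j @[s' --> input_nbhs s] --> within [set u | enorm u <= M] (nbhs (s j)).
Proof.
move=> Ks P /= /nbhs_ballP[e /= e0 eP].
have /andP[w0 w1] := w01 j.
exists (w j * e); first by rewrite /= mulr_gt0.
move=> s' /= [Ks' ss']; apply: eP; last exact: Ks'.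
split=> // i k; rewrite ord1 -ball_normE /= distrC.
have := le_lt_trans (ler_weighted_norm j Ks Ks') ss'.
rewrite ltr_pM2l //; apply: le_lt_trans.
by have := ler_entry_enorm (s' j - s j) i; rewrite !mxE.
Qed.

Lemma input_nbhs_fading_memory (F : input R n -> R) :
  null_sequence w -> (forall s, K_ M s -> F @ input_nbhs s --> F s) ->
  has_fading_memory M F.
Proof.
move=> w_null FF; exists w => // s Ks e e0.
have /cvgrPdist_lt /(_ e e0) [d d0 hd] := FF s Ks.
exists d => // s' Ks' ss'; rewrite distrC.
by apply: hd.
Qed.

(** An $\varepsilon/3$ argument: beyond some [J] both tails are small uniformly in the input, and
    the partial sum up to [J] depends on finitely many coordinates. *)
Lemma cvg_input_series (a : nat -> 'cV[R]_n -> R) (D q : R) (s : input R n) :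
  0 <= D -> 0 < q < 1 ->
  (forall j u, enorm u <= M -> `|a j u| <= D * q ^+ j) ->
  (forall j, {within [set u | enorm u <= M], continuous (a j)}) ->
  K_ M s ->
  limn (series (fun j => a j (s' j))) @[s' --> input_nbhs s] -->
    limn (series (fun j => a j (s j))).
Proof.
move=> D0 q01 aD ac Ks; apply/cvgrPdist_lt => e e0.
have /andP[q0 q1] := q01.
have e30 : 0 < e / 3 by rewrite divr_gt0.
have [J hJ] : exists J, D * q ^+ J / (1 - q) < e / 3.
  have : geometric (D / (1 - q)) q @ \oo --> (0 : R).
    by apply: cvg_geometric; rewrite ger0_norm // ltW.
  move=> /cvgrPdist_lt /(_ _ e30) [J _ /(_ J (leqnn J))].
  rewrite /= sub0r normrN => /(le_lt_trans (ler_norm _)).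
  by exists J; rewrite mulrAC.
have : series (fun j => a j (s' j)) J @[s' --> input_nbhs s] -->
    series (fun j => a j (s j)) J.
  rewrite /series /=; apply: cvg_big => [|j _]; first exact: add_continuous.
  have /subspace_continuousP /(_ (s j) (Ks j)) acj := ac j.
  by move=> P /acj; apply: cvg_input_coord.
move=> /cvgrPdist_lt /(_ _ e30); apply: filterS2 (near_input_nbhs s) => s' Ks'.
have := geometric_bound_tail D0 q01 (fun j => aD j _ (Ks j)) J.
have := geometric_bound_tail D0 q01 (fun j => aD j _ (Ks' j)) J.
set l := limn _; set l' := limn _; set x := series _ J; set y := series _ J.
move: hJ; set t := D * _ / _; rewrite !ler_norml !ltr_norml.
by move=> ? /andP[? ?] /andP[? ?] /andP[? ?]; apply/andP; split; lra.
Qed.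

End InputNeighbourhoods.

(** * Gaussian states with prescribed first moments *)

Section GaussianStates.
Variable R : realType.
Local Open Scope complex_scope.

Lemma complex_real_conj (z : R[i]) : z^* = z -> z \is Num.real.
Proof. by case: z => a b [] /eqP; rewrite eqNr complex_real. Qed.

(* The cross terms of the skew part are absorbed by the diagonal since
   |z_i z_j| <= (|z_i|^2 + |z_j|^2) / 2. *)
Lemma psd_scalar_skew (d : nat) (J : 'M[R]_d) :
  (forall i j, J j i = - J i j) -> (forall i j, `|J i j| <= 1) ->
  psd (map_mx (real_complex R) (d%:R%:M)
       + ('i%C / 2) *: map_mx (real_complex R) J).
Proof.
move=> Jskew J1 z.
have formE (X : 'M[R[i]]_d) : ((map_mx (@conjc R) z)^T *m X *m z) 0 0 =
    \sum_i \sum_j (z i 0)^* * X i j * z j 0.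
  rewrite mxE exchange_big /=; apply: eq_bigr => j _.
  by rewrite !mxE mulr_suml; apply: eq_bigr => i _; rewrite !mxE.
rewrite mulmxDr mulmxDl mxE !formE.
set t := \sum_i \sum_j _; set w := \sum_i \sum_j _.
have tE : t = d%:R * \sum_i `|z i 0| ^+ 2.
  rewrite mulr_sumr; apply: eq_bigr => i _.
  rewrite (bigD1 i) //= big1 => [|j ji]; last first.
    by rewrite !mxE eq_sym (negbTE ji) mulr0n rmorph0 mulr0 mul0r.
  by rewrite !mxE eqxx mulr1n rmorph_nat addr0 sqr_normc; ring.
(* A real skew matrix times $i/2$ is Hermitian, so its form is real and can be compared with [t]. *)
have wE : w^* = w.
  rewrite /w rmorph_sum exchange_big /=; apply: eq_bigr => i _.
  rewrite rmorph_sum; apply: eq_bigr => j _.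
  rewrite !rmorphM /= !mxE conjcK Jskew.
  have -> : ('i%C / 2 * (- J j i)%:C)^* = 'i%C / 2 * (J j i)%:C :> R[i].
    rewrite !rmorphM [_ _ (- J j i)%:C]conjc_real rmorphN fmorphV rmorph_nat.

    set c := (X in X / 2 * _); have -> : c = - 'i%C.
      by apply/eqP; rewrite eq_complex /= oppr0 !eqxx.
    by ring.
  by ring.
have w_le : `|w| <= t.
  (* The factor [d] lets the diagonal form be spread evenly over all pairs of indices. *)
  have -> : t = \sum_(i < d) \sum_(j < d) (`|z i 0| ^+ 2 + `|z j 0| ^+ 2) / 2.
    rewrite tE.
    have -> : \sum_(i < d) \sum_(j < d) (`|z i 0| ^+ 2 + `|z j 0| ^+ 2) / 2 =
        \sum_(i < d) (`|z i 0| ^+ 2 *+ d / 2 + (\sum_j `|z j 0| ^+ 2) / 2).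
      apply: eq_bigr => i _; rewrite -mulr_suml big_split /= mulrDl.
      by rewrite sumr_const card_ord.
    rewrite big_split /= -mulr_suml sumrMnl sumr_const card_ord.
    by field.
  rewrite (le_trans (ler_norm_sum _ _ _)) // ler_sum // => i _.
  rewrite (le_trans (ler_norm_sum _ _ _)) // ler_sum // => j _.
  rewrite !normrM !mxE normcJ.
  have half : `|'i%C / 2 * (J i j)%:C| <= 2^-1 :> R[i].
    rewrite !normrM normfV normr_nat (_ : `|'i%C| = 1) ?mul1r; last first.
      by rewrite normc_def /= expr0n expr1n add0r sqrtr1.
    rewrite ler_piMr ?invr_ge0 ?ler0n //.
    rewrite normc_def /= expr0n addr0 sqrtr_sqr.
    by rewrite -(rmorph1 (real_complex R)) lecR.
  rewrite -mulrA; apply: le_trans (ler_wpM2l _ (ler_wpM2r _ half)) _ => //.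
  rewrite -subr_ge0.
  have : 0 <= (`|z i 0| - `|z j 0|) ^+ 2.
    by rewrite real_exprn_even_ge0 // realB ?normr_real.
  move=> h; rewrite (_ : _ - _ =
    ((`|z i 0| - `|z j 0|) ^+ 2 + (`|z i 0| ^+ 2 + `|z j 0| ^+ 2)) / 4).
    by rewrite divr_ge0 // addr_ge0 // addr_ge0 // exprn_ge0.
  by field.
have wr := complex_real_conj wE.
by move: w_le; rewrite real_ler_norml // => /andP[+ _]; rewrite -subr_ge0 opprK addrC.
Qed.

(** Provides admissible initial states that share one covariance and have any chosen mean, so that
    the echo state property can be tested on differences of means. *)
Lemma gaussian_scalar_cov (m : nat) (x : 'cV[R]_(2 * m)) :
  gaussian (x, ((2 * m)%:R)%:M : 'M[R]_(2 * m)).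
Proof.
split; first by rewrite /= tr_scalar_mx.
apply: psd_scalar_skew => i j; rewrite !mxE.
  case: ifP => [/andP[oj /eqP ij]|_]; case: ifP => [/andP[oi /eqP ji]|_] //.
  - by have : (i < j)%N; [rewrite ji|rewrite ij ltnNge leqnSn].
  - by rewrite opprK.
  - by rewrite oppr0.
by do 2?[case: ifP => _]; rewrite ?normrN ?normr1 ?normr0 ?ler01.
Qed.

End GaussianStates.

(** * Closed form of the unrolled dynamics *)

Section ReservoirRun.
Variables (R : realType) (n m : nat) (A : 'M[R]_(2 * m)) (B : 'M[R]_(2 * m, 2)).
Variables (Omega : R) (e : encoding R n).
Let f := reservoir_step A B Omega e.
Let b u := B *m ancilla_mean Omega e u.
Let c u := B *m ancilla_cov Omega e u *m B^T.

(** [run] consumes the oldest input first, so the induction is over all initial states and the new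
    term enters at the top index of the sum. *)
Lemma run_meanE s k x : (run f s k x).1 =
  A ^+ k *m x.1 + \sum_(0 <= j < k) A ^+ j *m b (s j).
Proof.
elim: k x => [|k IH] x; first by rewrite big_geq // addr0 expr0 mul1mx.
by rewrite /= IH big_nat_recr //= mulmxDr mulmxA exprSr -mulmxE addrAC -addrA.
Qed.

Lemma run_covE s k x : (run f s k x).2 =
  A ^+ k *m x.2 *m (A ^+ k)^T + \sum_(0 <= j < k) A ^+ j *m c (s j) *m (A ^+ j)^T.
Proof.
elim: k x => [|k IH] x.
  by rewrite big_geq // addr0 expr0 mul1mx trmx1 mulmx1.
rewrite /= IH big_nat_recr //= mulmxDr mulmxDl !mulmxA.
rewrite exprSr -mulmxE trmx_mul !mulmxA.
by rewrite addrAC -addrA.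
Qed.

End ReservoirRun.

(** * Continuity of the ancilla moments in the input *)

Section EncodingContinuity.
Variables (R : realType) (n : nat) (D : set 'cV[R]_n) (e : encoding R n).
Variable Omega : R.
Hypotheses (n_th_cont : {within D, continuous (n_th e)})
  (squeeze_cont : {within D, continuous (squeeze e)})
  (phase_cont : {within D, continuous (phase e)})
  (amp_cont : {within D, continuous (amp e)})
  (arg_cont : {within D, continuous (arg e)}).

Lemma cvg_block_mx11 (T : Type) (F : set_system T) {FF : Filter F}
    (a b c d : T -> R) (a0 b0 c0 d0 : R) :
  a @ F --> a0 -> b @ F --> b0 -> c @ F --> c0 -> d @ F --> d0 ->
  forall i j,
  (block_mx (a t)%:M (b t)%:M (c t)%:M (d t)%:M : 'M[R]_(1 + 1)) i j @[t --> F] -->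
  (block_mx a0%:M b0%:M c0%:M d0%:M : 'M[R]_(1 + 1)) i j.
Proof.
move=> ha hb hc hd i j; rewrite !mxE.
under eq_fun do rewrite !mxE.
by case: (fintype.split i) => k; rewrite !mxE; under eq_fun do rewrite !mxE;
  case: (fintype.split j) => l; rewrite mxE; under eq_fun do rewrite mxE;
  rewrite (ord1 k) (ord1 l).
Qed.

Lemma ancilla_cov_cvg u i j : D u ->
  ancilla_cov Omega e v i j @[v --> within D (nbhs u)] --> ancilla_cov Omega e u i j.
Proof.
move=> Du.
have /subspace_continuousP /(_ u Du) nc := n_th_cont.
have /subspace_continuousP /(_ u Du) sc := squeeze_cont.
have /subspace_continuousP /(_ u Du) pc := phase_cont.
have cosc : cos (phase e v) @[v --> within D (nbhs u)] --> cos (phase e u).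
  by apply: (@continuous_cvg _ _ _ _ _ _ cos) pc; exact: continuous_cos.
have sinc : sin (phase e v) @[v --> within D (nbhs u)] --> sin (phase e u).
  by apply: (@continuous_cvg _ _ _ _ _ _ sin) pc; exact: continuous_sin.
have s2 : 2 * squeeze e v @[v --> within D (nbhs u)] --> 2 * squeeze e u.
  by apply: cvgM => //; exact: cvg_cst.
have ep : expR (2 * squeeze e v) @[v --> within D (nbhs u)] -->
    expR (2 * squeeze e u).
  by apply: (@continuous_cvg _ _ _ _ _ _ expR) s2; exact: continuous_expR.
have en : expR (- (2 * squeeze e v)) @[v --> within D (nbhs u)] -->
    expR (- (2 * squeeze e u)).
  apply: (@continuous_cvg _ _ _ _ _ _ expR); first exact: continuous_expR.
  exact: cvgN.
have ch : cosh (2 * squeeze e v) @[v --> within D (nbhs u)] -->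
    cosh (2 * squeeze e u).
  by apply: cvgM; [exact: cvgD|exact: cvg_cst].
have sh : sinh (2 * squeeze e v) @[v --> within D (nbhs u)] -->
    sinh (2 * squeeze e u).
  by apply: cvgM; [exact: cvgB|exact: cvg_cst].
rewrite /ancilla_cov mxE; under eq_fun do rewrite mxE.
apply: cvgM; first by apply: cvgD nc _; exact: cvg_cst.
apply: cvg_block_mx11.
- apply: cvgM; last exact: cvg_cst.
  by apply: cvgD ch _; exact: cvgM.
- exact: cvgM.
- exact: cvgM.
- apply: cvgM; last exact: cvg_cst.
  by apply: cvgB ch _; exact: cvgM.
Qed.

Lemma ancilla_mean_cvg u i j : D u ->
  ancilla_mean Omega e v i j @[v --> within D (nbhs u)] --> ancilla_mean Omega e u i j.
Proof.
move=> Du.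
have /subspace_continuousP /(_ u Du) ac := amp_cont.
have /subspace_continuousP /(_ u Du) pc := arg_cont.
have cosc : cos (arg e v) @[v --> within D (nbhs u)] --> cos (arg e u).
  by apply: (@continuous_cvg _ _ _ _ _ _ cos) pc; exact: continuous_cos.
have sinc : sin (arg e v) @[v --> within D (nbhs u)] --> sin (arg e u).
  by apply: (@continuous_cvg _ _ _ _ _ _ sin) pc; exact: continuous_sin.
rewrite /ancilla_mean mxE; under eq_fun do rewrite mxE.
by case: (fintype.split (i : 'I_(1 + 1))) => k; rewrite mxE; under eq_fun do rewrite mxE;
  rewrite (ord1 k) (ord1 j); apply: cvgM; do ?[exact: cvg_cst | exact: cvgM].
Qed.

End EncodingContinuity.

(** * Continuity on a subset for matrix-valued maps *)

Section WithinContinuity.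
Variables (R : realType) (T : topologicalType) (D : set T).

Lemma within_continuous_mulmx (p r t : nat) (X : T -> 'M[R]_(p, r))
    (Y : T -> 'M[R]_(r, t)) :
  (forall i j, {within D, continuous (fun u => X u i j)}) ->
  (forall i j, {within D, continuous (fun u => Y u i j)}) ->
  forall i j, {within D, continuous (fun u => (X u *m Y u) i j)}.
Proof.
move=> hX hY i j; apply/subspace_continuousP => u Du.
by apply: (@cvg_mulmx_entry _ _ (within D (nbhs u)) _) => k l;
  [have /subspace_continuousP := hX k l | have /subspace_continuousP := hY k l];
  apply.
Qed.

Lemma within_continuous_l1norm (p r : nat) (X : T -> 'M[R]_(p, r)) :
  (forall i j, {within D, continuous (fun u => X u i j)}) ->
  {within D, continuous (fun u => l1norm (X u))}.
Proof.
move=> hX; apply/subspace_continuousP => u Du.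
apply: (@cvg_big _ _ _ _ _ _ _ (within D (nbhs u))) => [|i _].
  exact: add_continuous.
apply: (@cvg_big _ _ _ _ _ _ _ (within D (nbhs u))) => [|j _].
  exact: add_continuous.
by apply: cvg_norm; have /subspace_continuousP := hX i j; apply.
Qed.

Lemma within_continuous_cst (a : R) : {within D, continuous (fun=> a)}.
Proof. by apply/subspace_continuousP => u Du; exact: cvg_cst. Qed.

End WithinContinuity.

(** * Vanishing sequences and vanishing matrix powers *)

Lemma geometric_bound_cvg0 (R : realType) (D q : R) (u : nat -> R) :
  0 <= D -> 0 < q < 1 -> (forall j, `|u j| <= D * q ^+ j) -> u @ \oo --> (0 : R).
Proof.
by move=> D0 q01 uD; apply: cvg_series_cvg_0; apply: geometric_bound_cvg uD.
Qed.

Section ConvergentPowers.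
Variables (R : realType) (d : nat) (A : 'M[R]_d).

(** Testing on basis vectors gives some $\|A^k\| < 1$. A left eigenvector satisfies $v A^k = z^k v$,
    so $|z|^k \le \|A^k\| < 1$ by submultiplicativity. *)
Lemma powers_cvg0_spectral_radius :
  (forall x i, (A ^+ k *m x : 'cV[R]_d) i 0 @[k --> \oo] --> (0 : R)) ->
  spectral_radius A < 1.
Proof.
move=> A0; apply: spectral_radius_lt1 => z /eigenvalueP[v vA v0].
have A0_norm : l1norm (A ^+ k) @[k --> \oo] --> (0 : R).
  have -> : 0 = l1norm (0 : 'M[R]_d).
    by rewrite /l1norm big1 // => i _; rewrite big1 // => j _; rewrite mxE normr0.
  apply: cvg_big => [|i _]; first exact: add_continuous.
  apply: cvg_big => [|j _]; first exact: add_continuous.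
  apply: cvg_norm; rewrite mxE.
  rewrite (_ : (fun k => _) = fun k => (A ^+ k *m delta_mx j (0 : 'I_1)) i 0).
    exact: A0.
  by apply: funext => k; rewrite -colE mxE.
have [k] : exists k, l1norm (A ^+ k) < 1.
  have /cvgrPdist_lt /(_ 1 ltr01) [k _ /(_ k (leqnn k))] := A0_norm.
  by rewrite /= sub0r normrN ger0_norm ?l1norm_ge0 //; exists k.
have v_gt0 : 0 < l1norm v.
  rewrite lt_neqAle l1norm_ge0 andbT eq_sym; apply: contraNneq v0 => nv0.
  apply/eqP/matrixP => i j; rewrite mxE; apply/eqP; rewrite -normr_le0 -nv0.
  exact: ler_l1norm_entry.
have vAk : v *m map_mx (real_complex R) (A ^+ k) = z ^+ k *: v.
  rewrite map_mx_complex_exp; elim: k {A0_norm} => [|k IH].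
    by rewrite !expr0 scale1r mulmx1.
  by rewrite exprSr -mulmxE mulmxA IH -scalemxAl vA scalerA -exprSr.
rewrite -(ltcR (l1norm _)) -l1norm_complex => Ak1.
have := ler_l1normM v (map_mx (real_complex R) (A ^+ k)).
rewrite vAk l1normZ mulrC ler_pM2l // normrX => zk.
(* The order on [R[i]] is partial; both sides being real permits the argument by contradiction. *)
rewrite real_ltNge ?normr_real ?real1 //; apply/negP => z1.
have := le_lt_trans (le_trans (exprn_ege1 k z1) zk) Ak1.
by rewrite rmorph1 ltxx.
Qed.

End ConvergentPowers.

(** * The echo state: necessity of the spectral bound, existence, continuity *)

Section EchoState.
Variables (R : realType) (n m : nat) (M : R) (A : 'M[R]_(2 * m)).
Variables (B : 'M[R]_(2 * m, 2)) (Omega : R) (e : encoding R n).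
Let D := [set u : 'cV[R]_n | enorm u <= M].
Let f := reservoir_step A B Omega e.
Let b u := B *m ancilla_mean Omega e u.
Let c u := B *m ancilla_cov Omega e u *m B^T.
Hypothesis M_ge0 : 0 <= M.

Lemma echo_state_spectral_radius :
  echo_state_property M f -> spectral_radius A < 1.
Proof.
(* One admissible input is enough; the zero sequence is admissible since [0 <= M]. *)
have K0 : K_ M ((fun=> 0) : input R n).
  move=> k; rewrite /enorm big1 ?sqrtr0 // => i _.
  by rewrite mxE expr0n.
move=> /(_ _ K0)[E EE]; apply: powers_cvg0_spectral_radius => x i.
have run_cvg y : (run f (fun=> 0) k (y, ((2 * m)%:R)%:M)).1 i 0 @[k --> \oo] -->
    E.1 i 0.
  have := EE _ (gaussian_scalar_cov y) => /(cvg_comp _ fst) h.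
  apply: (@continuous_cvg _ _ _ _ _ _ (fun X : 'cV[R]_(2 * m) => X i 0)).
    exact: coord_continuous.
  by apply: h; exact: cvg_fst.
(* The input contributions cancel between the runs with initial means [x] and 0. *)
have -> : (fun k => (A ^+ k *m x) i 0) = fun k =>
    (run f (fun=> 0) k (x, ((2 * m)%:R)%:M)).1 i 0
    - (run f (fun=> 0) k (0, ((2 * m)%:R)%:M)).1 i 0.
  apply: funext => k; rewrite !run_meanE /= mulmx0 add0r.
  set S := \sum_(_ <= _ < _) _.
  have -> : (A ^+ k *m x + S) i 0 = (A ^+ k *m x) i 0 + S i 0 by rewrite mxE.
  by rewrite addrK.
by rewrite -(subrr (E.1 i 0)); apply: cvgB.
Qed.

(** [limn] is total, so this candidate is defined before convergence of the series is known. *)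
Definition echo_limit (s : input R n) : 'cV[R]_(2 * m) * 'M[R]_(2 * m) :=
  (\col_i limn (series (fun j => (A ^+ j *m b (s j)) i 0)),
   \matrix_(k, l) limn (series (fun j => (A ^+ j *m c (s j) *m (A ^+ j)^T) k l))).

Lemma echo_limit_mean s i : (echo_limit s).1 i 0 =
  limn (series (fun j => (A ^+ j *m b (s j)) i 0)).
Proof. by rewrite mxE. Qed.

Lemma echo_limit_cov s k l : (echo_limit s).2 k l =
  limn (series (fun j => (A ^+ j *m c (s j) *m (A ^+ j)^T) k l)).
Proof. by rewrite mxE. Qed.

Hypotheses (n_th_cont : {within D, continuous (n_th e)})
  (squeeze_cont : {within D, continuous (squeeze e)})
  (phase_cont : {within D, continuous (phase e)})
  (amp_cont : {within D, continuous (amp e)})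
  (arg_cont : {within D, continuous (arg e)}).
Hypothesis A_lt1 : spectral_radius A < 1.

Lemma injected_mean_continuous i j : {within D, continuous (fun u => b u i j)}.
Proof.
apply: within_continuous_mulmx => k l; first exact: within_continuous_cst.
by apply/subspace_continuousP => u Du; exact: ancilla_mean_cvg.
Qed.

Lemma injected_cov_continuous i j : {within D, continuous (fun u => c u i j)}.
Proof.
apply: within_continuous_mulmx => k l; last exact: within_continuous_cst.
apply: within_continuous_mulmx => {}k {}l; first exact: within_continuous_cst.
by apply/subspace_continuousP => u Du; exact: ancilla_cov_cvg.
Qed.

Lemma mean_term_continuous t i j :
  {within D, continuous (fun u => (A ^+ t *m b u) i j)}.
Proof.
apply: within_continuous_mulmx; last exact: injected_mean_continuous.
by move=> k l; exact: within_continuous_cst.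
Qed.

Lemma cov_term_continuous t i j :
  {within D, continuous (fun u => (A ^+ t *m c u *m (A ^+ t)^T) i j)}.
Proof.
apply: within_continuous_mulmx => k l; last exact: within_continuous_cst.
apply: within_continuous_mulmx; last exact: injected_cov_continuous.
by move=> {}k {}l; exact: within_continuous_cst.
Qed.

(** The two factors $A^j$ give $q^{2j}$; one $q^j \le 1$ is dropped so that means and covariances
    share the same ratio. *)
Lemma l1norm_cov_term C q (X : 'M[R]_(2 * m)) j : 0 < q < 1 ->
  l1norm (A ^+ j) <= C * q ^+ j ->
  l1norm (A ^+ j *m X *m (A ^+ j)^T) <= C ^+ 2 * l1norm X * q ^+ j.
Proof.
move=> /andP[q0 q1] AC.
have Cq0 : 0 <= C * q ^+ j := le_trans (l1norm_ge0 _) AC.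
apply: le_trans (ler_l1normM _ _) _; rewrite l1norm_tr.
apply: (@le_trans _ _ (C * q ^+ j * l1norm X * (C * q ^+ j))).
  apply: ler_pM => //; [exact: l1norm_ge0|exact: l1norm_ge0|].
  apply: le_trans (ler_l1normM _ _) _; apply: ler_wpM2r => //.
  exact: l1norm_ge0.
rewrite (_ : _ * _ = C ^+ 2 * l1norm X * q ^+ j * q ^+ j); last by ring.
have q_ge0 := ltW q0; rewrite ler_piMr //; last by rewrite exprn_ile1 // ltW.
by rewrite mulr_ge0 ?exprn_ge0 // mulr_ge0 ?sqr_ge0 ?l1norm_ge0.
Qed.

Lemma echo_terms_bound : exists C q, [/\ 0 <= C, 0 < q < 1,
  forall j i u, D u -> `|(A ^+ j *m b u) i 0| <= C * q ^+ j,
  forall j k l u, D u -> `|(A ^+ j *m c u *m (A ^+ j)^T) k l| <= C * q ^+ j &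
  forall j, l1norm (A ^+ j) <= C * q ^+ j].
Proof.
have [C [q [C0 q01 AC]]] := spectral_radius_powers_geometric A_lt1.
have [Db Db0 hb] := continuous_ball_bounded (within_continuous_l1norm injected_mean_continuous).
have [Dc Dc0 hc] := continuous_ball_bounded (within_continuous_l1norm injected_cov_continuous).
have q_ge0 j : 0 <= q ^+ j by rewrite exprn_ge0 // ltW //; case/andP: q01.
have CD : 0 <= C * Db by rewrite mulr_ge0.
have CC : 0 <= C ^+ 2 * Dc by rewrite mulr_ge0 // sqr_ge0.
(* The sum of the constants for the means, the covariances and the bare powers serves all three
   bounds. *)
exists (C * Db + C ^+ 2 * Dc + C), q; split=> //.
- by rewrite !addr_ge0.
- move=> j i u Du; apply: le_trans (ler_l1norm_entry _ _ _) _.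
  apply: (@le_trans _ _ (C * Db * q ^+ j)).
    rewrite mulrAC; apply: le_trans (ler_l1normM _ _) _.
    by apply: ler_pM; rewrite ?l1norm_ge0 // (le_trans (ler_norm _)) // hb.
  by rewrite ler_wpM2r // -addrA lerDl addr_ge0.
- move=> j k l u Du; apply: le_trans (ler_l1norm_entry _ _ _) _.
  apply: le_trans (l1norm_cov_term _ q01 (AC j)) _.
  rewrite ler_wpM2r // (addrC (C * Db)) -addrA ler_wpDr ?addr_ge0 //.
  by rewrite ler_wpM2l ?sqr_ge0 // (le_trans (ler_norm _)) // hc.
- by move=> j; apply: le_trans (AC j) _; rewrite ler_wpM2r // lerDr addr_ge0.
Qed.

Lemma echo_limit_is_echo s : K_ M s -> is_echo f s (echo_limit s).
Proof.
move=> Ks x _; have [C [q [C0 q01 bC cC AC]]] := echo_terms_bound.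
have cvg1 : (run f s k x).1 @[k --> \oo] --> (echo_limit s).1.
  apply: cvg_mx_entries => i j; rewrite ord1 echo_limit_mean.
  (* The 0 is the limit of the initial-state term; the other summand is the limit of the partial
     sums. *)
  rewrite -[X in _ --> X]add0r.
  have E k : (run f s k x).1 i 0 =
      (A ^+ k *m x.1) i 0 + series (fun j => (A ^+ j *m b (s j)) i 0) k.
    by rewrite run_meanE mxE summxE.
  under eq_fun do rewrite E.
  apply: cvgD; last first.
    exact: (geometric_bound_cvg C0 q01 (fun j => bC j i _ (Ks j))).
  apply: (@geometric_bound_cvg0 _ (C * l1norm x.1) q) => //.
    by rewrite mulr_ge0 ?l1norm_ge0.
  move=> k; apply: le_trans (ler_l1norm_entry _ _ _) _.
  rewrite mulrAC; apply: le_trans (ler_l1normM _ _) _.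
  by rewrite ler_wpM2r ?l1norm_ge0.
have cvg2 : (run f s k x).2 @[k --> \oo] --> (echo_limit s).2.
  apply: cvg_mx_entries => i j; rewrite echo_limit_cov.
  rewrite -[X in _ --> X]add0r.
  have E k : (run f s k x).2 i j = (A ^+ k *m x.2 *m (A ^+ k)^T) i j +
      series (fun t => (A ^+ t *m c (s t) *m (A ^+ t)^T) i j) k.
    by rewrite run_covE mxE summxE.
  under eq_fun do rewrite E.
  apply: cvgD; last first.
    exact: (geometric_bound_cvg C0 q01 (fun t => cC t i j _ (Ks t))).
  apply: (@geometric_bound_cvg0 _ (C ^+ 2 * l1norm x.2) q) => //.
    by rewrite mulr_ge0 ?l1norm_ge0 ?sqr_ge0.
  move=> k; apply: le_trans (ler_l1norm_entry _ _ _) _.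
  exact: l1norm_cov_term.
rewrite [X in X @ _](_ : _ = fun k => ((run f s k x).1, (run f s k x).2)).
  rewrite [echo_limit s]surjective_pairing.
  exact: cvg_pair cvg1 cvg2.
by apply: funext => k; rewrite -surjective_pairing.
Qed.

(** [get] returns some echo of [s]; running one Gaussian state makes it and [echo_limit s] limits of
    the same sequence in a Hausdorff space. *)
Lemma induced_functional_echo_limit (h : gstate R m -> R) s : K_ M s ->
  induced_functional f h s = h (echo_limit s).
Proof.
move=> Ks; have EE := echo_limit_is_echo Ks.
have GE : is_echo f s (get (is_echo f s)) by apply: getPex; exists (echo_limit s).
rewrite /induced_functional; congr h.
have g := gaussian_scalar_cov (0 : 'cV[R]_(2 * m)).
by apply: (cvg_unique _ (GE _ g) (EE _ g)); exact: norm_hausdorff.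
Qed.

Lemma echo_limit_fading_memory (h : gstate R m -> R) :
  polynomial_readout h -> has_fading_memory M (fun s => h (echo_limit s)).
Proof.
move=> h_poly; have [C [q [C0 q01 bC cC AC]]] := echo_terms_bound.
have w01 k : 0 < (harmonic k : R) <= 1.
  by rewrite invr_gt0 ltr0n /= invf_le1 ?ltr0n // ler1n.
(* Any null sequence would do: the tails are uniform over [K_ M], and single coordinates only call
   for positive weights. *)
apply: (@input_nbhs_fading_memory R n M harmonic) => [|s Ks].
  split=> //; last exact: cvg_harmonic.
  apply/decreasing_seqP => k.
  by rewrite /harmonic /= ltf_pV2 ?posrE ?ltr0n // ltr_nat.
(* Exchanges pointwise equal functionals along the filter and at [s] simultaneously. *)
have transfer (u v : input R n -> R) : u =1 v ->
    v @ input_nbhs M harmonic s --> v s -> u @ input_nbhs M harmonic s --> u s.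
  by move=> /funext ->.
have cvg1 i : (echo_limit s').1 i 0 @[s' --> input_nbhs M harmonic s] -->
    (echo_limit s).1 i 0.
  apply: (transfer (fun s' => (echo_limit s').1 i 0) _
    (fun s' => echo_limit_mean s' i)).
  apply: (@cvg_input_series _ _ _ _ w01 (fun j u => (A ^+ j *m b u) i 0) C q) => //.
    by move=> j u; exact: bC.
  by move=> j; exact: mean_term_continuous.
have cvg2 i j : (echo_limit s').2 i j @[s' --> input_nbhs M harmonic s] -->
    (echo_limit s).2 i j.
  apply: (transfer (fun s' => (echo_limit s').2 i j) _
    (fun s' => echo_limit_cov s' i j)).
  apply: (@cvg_input_series _ _ _ _ w01
    (fun t u => (A ^+ t *m c u *m (A ^+ t)^T) i j) C q) => //.
    by move=> t u; exact: cC.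
  by move=> t; exact: cov_term_continuous.
case: h_poly => [[p hp]|[p hp]];
  apply: (transfer (fun s' => h (echo_limit s')) _ (fun s' => hp (echo_limit s'))).
  apply: (@cvg_meval _ _ _ _ _ _ (fun s' k => mxvec (echo_limit s').2 0 k)) => k.
  case/mxvec_indexP: k => i j.
  apply: (transfer (fun s' => mxvec (echo_limit s').2 0 (mxvec_index i j)) _
    (fun s' => mxvecE (echo_limit s').2 i j)).
  exact: cvg2.
exact: (@cvg_meval _ _ _ _ _ _ (fun s' k => (echo_limit s').1 k 0)).
Qed.

End EchoState.

Theorem lemma1 (R : realType) (n m : nat) (M dt : R)
  (omega : 'I_m.+1 -> R) (g : 'I_m.+1 -> 'I_m.+1 -> R)
  (S : R -> 'M[R]_(2 * m + 2)) (e : encoding R n) (h : gstate R m -> R)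
  (n_ge1 : (1 <= n)%N) (N_ge2 : (2 <= m.+1)%N) (M_gt0 : 0 < M) (dt_gt0 : 0 < dt)
  (omega_gt0 : forall i, 0 < omega i)
  (g_sym : forall i j, g i j = g j i) (g_ge0 : forall i j, 0 <= g i j)
  (g_diag : forall i, g i i = 0)
  (S_flow : is_hamiltonian_flow (potential omega g) S)
  (n_th_ge0 : forall u, enorm u <= M -> 0 <= n_th e u)
  (amp_ge0 : forall u, enorm u <= M -> 0 <= amp e u)
  (n_th_cont : {within [set u | enorm u <= M], continuous (n_th e)})
  (squeeze_cont : {within [set u | enorm u <= M], continuous (squeeze e)})
  (phase_cont : {within [set u | enorm u <= M], continuous (phase e)})
  (amp_cont : {within [set u | enorm u <= M], continuous (amp e)})
  (arg_cont : {within [set u | enorm u <= M], continuous (arg e)})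
  (h_poly : polynomial_readout h) :
  let A : 'M[R]_(2 * m) := ulsubmx (S dt) in
  let B : 'M[R]_(2 * m, 2) := ursubmx (S dt) in
  let f := reservoir_step A B (omega ord_max) e in
  (echo_state_property M f /\ fading_memory_property M f h)
    <-> spectral_radius A < 1.

Proof.
move=> A B f; split=> [[esp _]|A1].
  exact: echo_state_spectral_radius (ltW M_gt0) esp.
have limE := induced_functional_echo_limit B (omega ord_max) n_th_cont
  squeeze_cont phase_cont amp_cont arg_cont A1.
split.
  by move=> s Ks; eexists; apply: echo_limit_is_echo Ks.
have [w w_null hw] := echo_limit_fading_memory B (omega ord_max) n_th_cont
  squeeze_cont phase_cont amp_cont arg_cont A1 h_poly.
(* Both inputs compared lie in [K_ M], where the induced functional is [h] of the echo limit. *)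
exists w => // s Ks eps eps0; have [d d0 hd] := hw s Ks eps eps0.
by exists d => // s' Ks' ss'; rewrite !limE //; apply: hd.
Qed.
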